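(* Let $n\ge1$. The virtual symplectic cactus group $\widetilde J_{2n}$ is isomorphic to a subgroup of the cactus group $J_{2n}$.
   Context: Intervals $[p,q]=\{p,\dots,q\}$, $p\le q$, are viewed as connected sub-diagrams of a Dynkin diagram. A union $J\sqcup J'$ of two sub-diagrams is disconnected if no node of $J$ equals or is adjacent to a node of $J'$. The cactus group $J_{2n}=J_{\mathfrak{sl}(2n,\mathbb C)}$ is the group with generators $s_{[p,q]}$, $[p,q]\subseteq[2n-1]$, and relations: $s_J^2=1$; $s_Js_{J'}=s_{J'}s_J$ if $J\sqcup J'$ is disconnected; $s_{[p,q]}s_{[k,l]}=s_{[p+q-l,p+q-k]}s_{[p,q]}$ for $[k,l]\subset[p,q]\subseteq[2n-1]$. The virtual symplectic cactus group $\widetilde J_{2n}$ is the group with generators $\tilde s_J$, where $J$ runs over the sub-diagrams of $[2n-1]$ (the $A_{2n-1}$ Dynkin diagram) of the form $J=[p,2n-p]$ with $1\le p\le n$, or $J=[p,q]\sqcup[2n-q,2n-p]$ with $[p,q]\subseteq[n-1]$, subject to the relations: (1) $\tilde s_J^2=1$; (2) $\tilde s_J\tilde s_{J'}=\tilde s_{J'}\tilde s_J$ whenever $J\sqcup J'$ is disconnected (no node of $J$ equal or adjacent to a node of $J'$); (3)(i) $\tilde s_{[p,2n-p]}$ commutes with $\tilde s_{[q,l]\sqcup[2n-l,2n-q]}$ for $[q,l]\subseteq[p,n]\subseteq[n]$ (where for $l=n$ the index $[q,n]\sqcup[n,2n-q]$ means $[q,2n-q]$); (3)(ii) $\tilde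 s_{[p,q]\sqcup[2n-q,2n-p]}\,\tilde s_{[k,l]\sqcup[2n-l,2n-k]}=\tilde s_{[p+q-l,p+q-k]\sqcup[2n-(p+q)+k,\,2n-(p+q)+l]}\,\tilde s_{[p,q]\sqcup[2n-q,2n-p]}$ for $[k,l]\subseteq[p,q]\subseteq[n-1]$. *)

(* Defs.v *)
From HB Require Import structures.
From mathcomp Require Import all_boot.
From mathcomp Require Import boolp.

Set Implicit Arguments.
Unset Strict Implicit.
Unset Printing Implicit Defensive.

Local Open Scope quotient_scope.

(* Words in T and its formal inverses: (x, false) stands for x and (x, true)  *)
(* for x^-1.                                                                  *)
Definition word (T : Type) : Type := seq (T * bool).

Definition letter (T : Type) (x : T) : T * bool := (x, false).

Definition inv_letter (T : Type) (a : T * bool) : T * bool := (a.1, ~~ a.2).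

Definition inv_word (T : Type) (w : word T) : word T :=
  rev (map (@inv_letter T) w).

(* The congruence whose quotient is the group < T | u = v for R u v >.        *)
Inductive pres_eq (T : Type) (R : word T -> word T -> Prop) :
    word T -> word T -> Prop :=
| PresRel u v of R u v : pres_eq R u v
| PresCancel a : pres_eq R [:: a; inv_letter a] [::]
| PresRefl u : pres_eq R u u
| PresSym u v of pres_eq R u v : pres_eq R v u
| PresTrans u v w of pres_eq R u v & pres_eq R v w : pres_eq R u w
| PresCat u u' v v' of pres_eq R u u' & pres_eq R v v' :
    pres_eq R (u ++ v) (u' ++ v').

Section PresentedGroup.

Variables (T : choiceType) (R : word T -> word T -> Prop).

Definition pres_eqb (u v : word T) : bool := `[< pres_eq R u v >].

Lemma pres_eqb_refl : reflexive pres_eqb.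
Proof. by move=> u; apply/asboolP/PresRefl. Qed.

Lemma pres_eqb_sym : symmetric pres_eqb.
Proof. by move=> u v; apply/asboolP/asboolP => /PresSym. Qed.

Lemma pres_eqb_trans : transitive pres_eqb.
Proof.
by move=> v u w /asboolP uv /asboolP vw; apply/asboolP/(PresTrans uv vw).
Qed.

Canonical pres_equiv :=
  EquivRel pres_eqb pres_eqb_refl pres_eqb_sym pres_eqb_trans.

Definition presented : Type := {eq_quot pres_equiv}.

HB.instance Definition _ := Choice.on presented.
HB.instance Definition _ := EqQuotient.on presented.

Lemma presentedP (u v : word T) :
  \pi_presented u = \pi_presented v <-> pres_eq R u v.
Proof.
split=> [/eqmodP /asboolP //|uv].
by apply/eqmodP/asboolP.
Qed.

Definition pres_one : presented := \pi_presented [::].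
Definition pres_mul (x y : presented) : presented :=
  \pi_presented (repr x ++ repr y).
Definition pres_inv (x : presented) : presented :=
  \pi_presented (inv_word (repr x)).

Lemma pres_repr (u : word T) : pres_eq R (repr (\pi_presented u)) u.
Proof. by apply/presentedP; rewrite reprK. Qed.

Lemma pres_mulE (u v : word T) :
  pres_mul (\pi_presented u) (\pi_presented v) = \pi_presented (u ++ v).
Proof. by apply/presentedP/PresCat; apply: pres_repr. Qed.

Lemma inv_letterK : involutive (@inv_letter T).
Proof. by case=> x b; rewrite /inv_letter negbK. Qed.

Lemma inv_wordK : involutive (@inv_word T).
Proof.
move=> u; rewrite /inv_word map_rev revK -map_comp -[RHS]map_id.
by apply: eq_map => a /=; apply: inv_letterK.
Qed.

Lemma pres_catV (u : word T) : pres_eq R (u ++ inv_word u) [::].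
Proof.
elim: u => [|a u IH]; first exact: PresRefl.
have -> : (a :: u) ++ inv_word (a :: u) =
    [:: a] ++ ((u ++ inv_word u) ++ [:: inv_letter a]).
  by rewrite /inv_word /= rev_cons -cats1 catA.
apply: PresTrans (PresCancel R a).
apply: (@PresCat _ R [:: a] [:: a] _ [:: inv_letter a]); first exact: PresRefl.
exact: (PresCat IH (PresRefl R [:: inv_letter a])).
Qed.

Lemma pres_mulA : associative pres_mul.
Proof.
move=> x y z; rewrite -[x]reprK -[y]reprK -[z]reprK.
move: (repr x) (repr y) (repr z) => u v w.
by rewrite (pres_mulE v w) (pres_mulE u v) !pres_mulE catA.
Qed.

Lemma pres_mul1 : left_id pres_one pres_mul.
Proof. by move=> x; rewrite -[x]reprK pres_mulE. Qed.

Lemma pres_mulr1 : right_id pres_one pres_mul.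
Proof. by move=> x; rewrite -[x]reprK pres_mulE cats0. Qed.

Lemma pres_mulV : right_inverse pres_one pres_inv pres_mul.
Proof.
move=> x; rewrite /pres_inv -[X in pres_mul X]reprK pres_mulE.
exact/presentedP/pres_catV.
Qed.

Lemma pres_Vmul : left_inverse pres_one pres_inv pres_mul.
Proof.
move=> x; rewrite /pres_inv -[X in pres_mul _ X]reprK pres_mulE.
by apply/presentedP; rewrite -{2}[repr x]inv_wordK; apply: pres_catV.
Qed.

HB.instance Definition _ :=
  isGroup.Build presented pres_mulA pres_mul1 pres_mulr1 pres_Vmul pres_mulV.

Definition pres_gen (x : T) : presented := \pi_presented [:: letter x].

Local Open Scope group_scope.

Definition eval_word (G : groupType) (phi : T -> G) (w : word T) : G :=
  \prod_(a <- w) (if a.2 then (phi a.1)^-1 else phi a.1).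

Lemma pi_cat (u v : word T) :
  \pi_presented (u ++ v) = \pi_presented u * \pi_presented v.
Proof. by rewrite -pres_mulE. Qed.

Lemma pi_eval (w : word T) : \pi_presented w = eval_word pres_gen w.
Proof.
elim: w => [|[x b] w IH]; first by rewrite /eval_word big_nil.
rewrite -cat1s pi_cat IH /eval_word [RHS]big_cons; congr (_ * _).
case: b => //=; apply: (mulgI (pres_gen x)); rewrite mulgV -pi_cat.
exact/presentedP/(PresCancel R (letter x)).
Qed.

Lemma presented_universal (G : groupType) (phi : T -> G) :
  (forall u v, R u v -> eval_word phi u = eval_word phi v) ->
  exists f : {multiplicative presented -> G},
    (forall x, f (pres_gen x) = phi x) /\
    (forall g : {multiplicative presented -> G},
       (forall x, g (pres_gen x) = phi x) -> g =1 f).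
Proof.
move=> phiR.
have evc u v : eval_word phi (u ++ v) = eval_word phi u * eval_word phi v.
  by rewrite /eval_word big_cat.
have evR u v : pres_eq R u v -> eval_word phi u = eval_word phi v.
  elim=> {u v} [u v /phiR//|[x b]|//|//|u v w _ -> _ -> //|u u' v v' _ IHu _ IHv].
  - by rewrite /eval_word !big_cons big_nil /= mulg1; case: b;
      rewrite /= ?mulgV ?mulVg.
  - by rewrite !evc IHu IHv.
pose F (x : presented) := eval_word phi (repr x).
have FM : {morph F : x y / x * y}.
  move=> x y; rewrite -[x]reprK -[y]reprK -pi_cat /F.
  by rewrite (evR _ _ (pres_repr _)) evc !reprK.
pose mF := isMultiplicative.Build _ _ F FM.
pose f : {multiplicative presented -> G} := HB.pack F mF.
exists f; split=> [x|g gE x].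
  by rewrite /= /F (evR _ _ (pres_repr _)) /eval_word big_cons big_nil mulg1.
have g1 : g 1 = 1 by apply: (mulgI (g 1)); rewrite -gmulfM !mulg1.
rewrite -[x]reprK /= /F (evR _ _ (pres_repr _)).
elim: (repr x) => [|[y b] w IH]; first by rewrite /eval_word big_nil.
rewrite -cat1s pi_cat gmulfM IH evc; congr (_ * _).
rewrite pi_eval /eval_word !big_cons !big_nil !mulg1 /=.
case: b; rewrite ?gE //; apply: (mulgI (phi y)).
by rewrite mulgV -gE -gmulfM mulgV.
Qed.

End PresentedGroup.

(* A sub-diagram of A_{2n-1} is the set of its nodes. The nodes 1, ..., 2n-1  *)
(* are the nonzero elements of 'I_(2 * n); no generator below involves 0.     *)
Definition diagram (n : nat) : Type := {set 'I_(2 * n)}.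

Definition itv (n p q : nat) : diagram n := [set i : 'I_(2 * n) | p <= i <= q].

Definition disconnected (n : nat) (J J' : diagram n) : Prop :=
  forall i j : 'I_(2 * n), i \in J -> j \in J' ->
    [/\ i <> j, i.+1 <> j :> nat & j.+1 <> i :> nat].

Definition is_interval (n : nat) (J : diagram n) : Prop :=
  exists p q, [/\ 1 <= p, p <= q, q <= (2 * n).-1 & J = itv n p q].

Definition cactus_gen (n : nat) : Type :=
  {J : {set 'I_(2 * n)} | `[< is_interval J >]}.

Inductive cactus_rel (n : nat) :
    word (cactus_gen n) -> word (cactus_gen n) -> Prop :=
| CactusInvol J :
    cactus_rel [:: letter J; letter J] [::]
| CactusComm J J' of disconnected (val J) (val J') :
    cactus_rel [:: letter J; letter J'] [:: letter J'; letter J]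
| CactusFlip p q k l J K K' of
    1 <= p & p <= k & k <= l & l <= q & q <= (2 * n).-1
    & val J = itv n p q & val K = itv n k l
    & val K' = itv n (p + q - l) (p + q - k) :
    cactus_rel [:: letter J; letter K] [:: letter K'; letter J].

Definition cactus (n : nat) : groupType := presented (@cactus_rel n).

(* [p,q] together with its mirror image [2n-q,2n-p]; for q = n the two halves *)
(* overlap in the node n and the union is the interval [p,2n-p], cf. ditv_n.  *)
Definition ditv (n p q : nat) : diagram n :=
  itv n p q :|: itv n (2 * n - q) (2 * n - p).

Lemma ditv_n (n p : nat) : p <= n -> ditv n p n = itv n p (2 * n - p).
Proof.
move=> pn; apply/setP => i; rewrite !inE.
have -> : 2 * n - n = n by rewrite mul2n -addnn addnK.
have nq : n <= 2 * n - p by rewrite mul2n -addnn -addnBA // leq_addr.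
case: (leqP i n) => [le_in|lt_ni]; last first.
  by rewrite andbF /= (ltnW lt_ni) (leq_trans pn (ltnW lt_ni)).
rewrite andbT (leq_trans le_in nq) !andbT.
by apply/orP/idP => [[//|]|->]; [apply: leq_trans | left].
Qed.

Definition is_virtual (n : nat) (J : diagram n) : Prop :=
  (exists p, [/\ 1 <= p, p <= n & J = itv n p (2 * n - p)]) \/
  (exists p q, [/\ 1 <= p, p <= q, q <= n.-1 & J = ditv n p q]).

Definition virtual_gen (n : nat) : Type :=
  {J : {set 'I_(2 * n)} | `[< is_virtual J >]}.

Inductive virtual_rel (n : nat) :
    word (virtual_gen n) -> word (virtual_gen n) -> Prop :=
| VirtualInvol J :
    virtual_rel [:: letter J; letter J] [::]
| VirtualComm J J' of disconnected (val J) (val J') :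
    virtual_rel [:: letter J; letter J'] [:: letter J'; letter J]
| VirtualCentral p q l J K of
    1 <= p & p <= q & q <= l & l <= n
    & val J = itv n p (2 * n - p) & val K = ditv n q l :
    virtual_rel [:: letter J; letter K] [:: letter K; letter J]
| VirtualFlip p q k l J K K' of
    1 <= p & p <= k & k <= l & l <= q & q <= n.-1
    & val J = ditv n p q & val K = ditv n k l
    & val K' = ditv n (p + q - l) (p + q - k) :
    virtual_rel [:: letter J; letter K] [:: letter K'; letter J].

Definition virtual_cactus (n : nat) : groupType := presented (@virtual_rel n).

(* Main.v *)
Require Import Defs.
From mathcomp Require Import all_boot.
From HB Require Import structures.
From mathcomp Require Import order ssralg ssrnum ssrint boolp zify ring.

Set Implicit Arguments.
Unset Strict Implicit.
Unset Printing Implicit Defensive.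

Import Order.TTheory GRing.Theory Num.Theory.

(** The generator on [p,q] + [2n-q,2n-p] is sent to s_[p,q] s_[2n-q,2n-p], and
    the one on [p,2n-p] to s_[p,2n-p].  The defining relations of the virtual
    group hold for these images ([virtualization]); the content of the theorem
    is that the resulting morphism is injective.

    Injectivity comes from comparing the cactus group with a right-angled
    Coxeter group.  Replace the diagram [p,q] by the set {p,...,q+1} of strands
    that s_[p,q] reverses: disconnected diagrams become disjoint sets.  Take one
    Coxeter generator for each set A of strands, two of them commuting when the
    sets are nested or disjoint and generating a free product otherwise.  The
    cactus group maps to the semidirect product of this Coxeter group with the
    permutations of the strands: s_[p,q] is sent to the generator of its set of
    strands times the reversal of that set.  Hence it acts on the dual of the
    Tits representation, that is, on integer functions f of a set of strands
    ([cactus_act]).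

    Write a virtual element as a word of minimal length and apply its image to
    the constant function 1, a point of the fundamental chamber.  As in Tits'
    argument, f (A) < 0 means that the wall of A separates the chamber reached
    from the fundamental one.  The following is shown by induction on the word
    ([certified_cons]): if f (A) < 0 for a set A belonging to a virtual
    generator, then multiplying by that generator shortens the word.
    So minimality keeps f positive on the sets of the next generator applied,
    and applying that generator makes f negative there ([vimage_act_positive]).
    After at least one letter f differs from the constant 1, so no nontrivial
    element is in the kernel.

    The induction step needs that the virtual relations are rich enough: if both
    sets of a virtual generator K are nested with or disjoint from a set A of a
    virtual generator J, then the word J K can be rewritten as K' J' by a
    virtual relation, J' having the set which K transports to A
    ([vgen_exchange]).
    Indeed two half-sets on opposite sides of the middle are always disjoint, so
    A meets at most one half of K unless J or K is symmetric, and a symmetric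
    generator commutes with every generator nested in it. *)

(** * Reflections attached to sets of strands *)

Section Reflections.
Local Open Scope ring_scope.

Definition laminar (A B : nat -> bool) : Prop :=
  [\/ forall x, A x -> B x, forall x, B x -> A x | forall x, ~~ (A x && B x)].

(** Minus twice the bilinear form of the Coxeter group in which laminar pairs
    commute and all other pairs have no relation. *)
Definition form (S A : nat -> bool) : int :=
  if `[< S = A >] then -2 else if `[< laminar S A >] then 0 else 2.

(** The dual action of the simple reflection S on the values of a linear form at
    the simple roots A. *)
Definition refl_at (S : nat -> bool) (f : (nat -> bool) -> int) A : int :=
  f A + form S A * f S.

(** The action of the pair (S, r) in the semidirect product of the Coxeter group
    with the permutations of the strands. *)
Definition twisted_refl (S : nat -> bool) (r : nat -> nat)
    (f : (nat -> bool) -> int) :=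
  refl_at S (fun A => f (A \o r)).

Lemma laminar_sym A B : laminar A B -> laminar B A.
Proof.
by case=> h; [constructor 2|constructor 1|constructor 3 => x; rewrite andbC].
Qed.

Lemma laminar_refl A : laminar A A.
Proof. by constructor 1. Qed.

Lemma laminar_comp r A B : laminar A B -> laminar (A \o r) (B \o r).
Proof.
by case=> h; [constructor 1|constructor 2|constructor 3] => x /=; apply: h.
Qed.

Lemma comp_involK (r : nat -> nat) (A : nat -> bool) : involutive r ->
  A \o r \o r = A.
Proof. by move=> rK; apply/funext=> x /=; rewrite rK. Qed.

Lemma form_comp r S A : involutive r -> form S (A \o r) = form (S \o r) A.
Proof.
move=> rK; rewrite /form.
have -> : `[< S = A \o r >] = `[< S \o r = A >].
  by apply: asbool_equiv_eq; split=> [->|<-]; rewrite comp_involK.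
have -> // : `[< laminar S (A \o r) >] = `[< laminar (S \o r) A >].
by apply: asbool_equiv_eq; split=> /(laminar_comp r); rewrite comp_involK.
Qed.

Lemma formSS S : form S S = -2.
Proof. by rewrite /form asboolT. Qed.

Lemma form_laminar S T : laminar S T -> S <> T -> form S T = 0.
Proof. by move=> h ST; rewrite /form asboolF // asboolT. Qed.

Lemma refl_atK S : involutive (refl_at S).
Proof. by move=> f; apply/funext=> A; rewrite /refl_at formSS; ring. Qed.

Lemma refl_at_comm S T f : laminar S T ->
  refl_at S (refl_at T f) = refl_at T (refl_at S f).
Proof.
case: (pselect (S = T)) => [->//|ST h]; apply/funext=> A; rewrite /refl_at.
rewrite (form_laminar h ST) (form_laminar (laminar_sym h)); first ring.
by move=> TS; apply: ST.
Qed.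

Lemma twisted_reflK S r : involutive r -> S \o r = S ->
  involutive (twisted_refl S r).
Proof.
move=> rK Sr f; rewrite -[RHS](refl_atK S); congr refl_at; apply/funext=> A.
by rewrite /twisted_refl /refl_at form_comp // !Sr /= comp_involK.
Qed.

(** The common source of the commutation and the flip relations: when r maps
    (T, t) to (T', t'), moving (S, r) across costs only the commutation of the
    reflections in S and T'. *)
Lemma twisted_refl_exchange S r T t T' t' f : involutive r -> involutive t' ->
  T \o r = T' -> S \o t' = S -> r \o t = t' \o r -> laminar S T' ->
  twisted_refl S r (twisted_refl T t f) =
    twisted_refl T' t' (twisted_refl S r f).
Proof.
move=> rK tK <- St rt ST.
have -> : twisted_refl S r (twisted_refl T t f) =
    refl_at S (refl_at (T \o r) (fun A => f (A \o (r \o t)))).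
  congr refl_at; apply/funext=> A; rewrite /twisted_refl /refl_at form_comp //.
  by congr (_ + _ * f _); apply/funext=> x /=; rewrite rK.
rewrite refl_at_comm // rt; congr refl_at; apply/funext=> A.
have Str : S \o (t' \o r) = S \o r by rewrite -{2}St.
by rewrite /twisted_refl /refl_at form_comp // St Str.
Qed.

(** The invariant of the orbit of the fundamental chamber that controls signs.
    Positivity of the sum over a crossing pair says that at most one of the two
    values is negative, and then the smaller in absolute value; this is what
    keeps the signs away from S unchanged, or turns them positive, when one
    reflects in S with f (S) > 0. *)
Definition positive_pairs (f : (nat -> bool) -> int) : Prop :=
  (forall A, f A != 0) /\ (forall A B, ~ laminar A B -> 0 < f A + f B).

Lemma positive_comp r f : involutive r -> positive_pairs f ->
  positive_pairs (fun A => f (A \o r)).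
Proof.
move=> rK [f0 fp]; split=> // A B nAB; apply: fp => /(laminar_comp r).
by rewrite !comp_involK.
Qed.

Lemma positive_refl_at S f :
  positive_pairs f -> 0 < f S -> positive_pairs (refl_at S f).
Proof.
move=> [f0 fp] S0; rewrite /refl_at /form; split=> [A|A B nAB].
  case: asboolP => [<-|_]; first by move: (f0 S); lia.
  case: asboolP => [_|/fp]; last lia.
  by rewrite mul0r addr0.
case: (pselect (S = A)) => SA; case: (pselect (S = B)) => SB.
- by case: nAB; rewrite -SA -SB; apply: laminar_refl.
- subst A; rewrite (asboolT (erefl S)) (asboolF SB) (asboolF nAB).
  by have := fp _ _ nAB; lia.
- subst B; rewrite (asboolT (erefl S)) (asboolF SA).
  rewrite asboolF; last by move/laminar_sym.
  by have := fp _ _ nAB; lia.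
- rewrite !(asboolF SA) !(asboolF SB); have := fp _ _ nAB.
  by do 2!case: asboolP => _; lia.
Qed.

(** Where A crosses S, the new value f A + 2 f S exceeds f A + f S > 0; so the
    reflection creates no negative value except at S itself. *)
Lemma refl_at_negative S f A : positive_pairs f -> 0 < f S ->
  refl_at S f A < 0 ->
  A = S \/ [/\ A <> S, laminar A S & f A < 0].
Proof.
move=> [_ fp] S0; rewrite /refl_at /form.
case: asboolP => [|SA]; first by left.
case: asboolP => [|/fp]; last lia.
rewrite mul0r addr0 => /laminar_sym AS fA; right; split=> // E; exact: SA.
Qed.

Lemma twisted_refl_positive S r f : involutive r -> S \o r = S ->
  positive_pairs f -> 0 < f S -> positive_pairs (twisted_refl S r f).
Proof.
move=> rK Sr fp S0; apply: positive_refl_at; last by rewrite Sr.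
exact: positive_comp.
Qed.

Lemma twisted_refl_negative S r f A : involutive r -> S \o r = S ->
  positive_pairs f -> (0 < f S) -> (twisted_refl S r f A < 0) ->
  A = S \/ [/\ A <> S, laminar A S & (f (A \o r) < 0)].
Proof.
move=> rK Sr fp S0; apply: refl_at_negative; last by rewrite Sr.
exact: positive_comp.
Qed.

Lemma twisted_refl_self S r f : S \o r = S -> twisted_refl S r f S = (- f S).
Proof. by move=> Sr; rewrite /twisted_refl /refl_at Sr formSS; ring. Qed.

End Reflections.

(** * Intervals of strands and their reversals *)

Definition seg (a b : nat) : nat -> bool := fun x => a <= x <= b.
Definition rev_seg (a b x : nat) : nat := if a <= x <= b then a + b - x else x.

(** Node i of the diagram joins strands i and i+1, so the nodes p..q involve the
    strands p..q+1. *)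
Definition cactus_flip (p q : nat) :=
  twisted_refl (seg p q.+1) (rev_seg p q.+1).

Lemma rev_segK a b : involutive (rev_seg a b).
Proof. by move=> x; rewrite /rev_seg; do !case: ifP; lia. Qed.

Ltac seg_lia :=
  rewrite /seg /rev_seg; try (apply/funext=> ? /=); do ?case: ifP; lia.

Lemma seg_rev a b : seg a b \o rev_seg a b = seg a b.
Proof. seg_lia. Qed.

Lemma seg_rev_far a b c d : (b < c) || (d < a) ->
  seg c d \o rev_seg a b = seg c d.
Proof. move=> H; seg_lia. Qed.

Lemma seg_rev_in a b c d : a <= c -> c <= d -> d <= b ->
  seg c d \o rev_seg a b = seg (a + b - d) (a + b - c).
Proof. move=> ???; seg_lia. Qed.

Lemma seg_rev_out a b c d : c <= a -> b <= d ->
  seg c d \o rev_seg a b = seg c d.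
Proof. move=> ??; seg_lia. Qed.

Lemma laminar_seg a b c d : a <= b -> c <= d -> laminar (seg a b) (seg c d) ->
  [\/ b < c, d < a, (a <= c) && (d <= b) | (c <= a) && (b <= d)].
Proof.
move=> ab cd; rewrite /seg; case=> h.
- by constructor 4; move: (h a) (h b); lia.
- by constructor 3; move: (h c) (h d); lia.
move: (h (maxn a c)) => {}h.
case: (ltnP b c) => ?; first by constructor 1.
by constructor 2; lia.
Qed.

Lemma seg_inj a b c d : a <= b -> seg a b = seg c d -> a = c /\ b = d.
Proof.
move=> ab E; have h x : (a <= x <= b) = (c <= x <= d) := congr1 (@^~ x) E.
by move: (h a) (h b) (h c) (h d); lia.
Qed.

Lemma cactus_flipK p q : involutive (cactus_flip p q).
Proof. by apply: twisted_reflK; [apply: rev_segK | apply: seg_rev]. Qed.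

Lemma cactus_flip_far p q k l f : p <= q -> k <= l ->
  (q.+1 < k) || (l.+1 < p) ->
  cactus_flip p q (cactus_flip k l f) = cactus_flip k l (cactus_flip p q f).
Proof.
move=> pq kl far; apply: twisted_refl_exchange; try apply: rev_segK.
- by apply: seg_rev_far; lia.
- by apply: seg_rev_far; lia.
- by seg_lia.
- by constructor 3 => x; rewrite /seg; lia.
Qed.

Lemma cactus_flip_nested p q k l f : p <= k -> k <= l -> l <= q ->
  cactus_flip p q (cactus_flip k l f) =
    cactus_flip (p + q - l) (p + q - k) (cactus_flip p q f).
Proof.
move=> pk kl lq; apply: twisted_refl_exchange; try apply: rev_segK.
- by rewrite seg_rev_in; [congr seg; lia|lia..].
- by apply: seg_rev_out; lia.
- by seg_lia.
- by constructor 2 => x; rewrite /seg; lia.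
Qed.


(** * Groups presented by involutions *)

Section InvolutivePresentation.
Local Open Scope quotient_scope.
Local Open Scope group_scope.
Variables (T : choiceType) (R : word T -> word T -> Prop).

Lemma pi_rel u v : R u v -> \pi_(presented R) u = \pi_(presented R) v.
Proof. by move=> uv; apply/presentedP/PresRel. Qed.

Lemma eval_two (G : groupType) (phi : T -> G) s t :
  eval_word phi [:: letter s; letter t] = phi s * phi t.
Proof. by rewrite /eval_word !big_cons big_nil mulg1. Qed.

Lemma pres_gen2 s t :
  pres_gen R s * pres_gen R t = \pi_(presented R) [:: letter s; letter t].
Proof. by rewrite pi_eval eval_two. Qed.

Lemma pres_rel2 s t u v :
  R [:: letter s; letter t] [:: letter u; letter v] ->
  pres_gen R s * pres_gen R t = pres_gen R u * pres_gen R v.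
Proof. by move=> r; rewrite !pres_gen2 (pi_rel r). Qed.

Hypothesis R_inv : forall t, R [:: letter t; letter t] [::].

Lemma pres_gen_sqr t : pres_gen R t * pres_gen R t = 1.
Proof. by rewrite pres_gen2 (pi_rel (R_inv t)). Qed.

Lemma pres_gen_prod (g : presented R) :
  exists s : seq T, g = \prod_(t <- s) pres_gen R t.
Proof.
exists (map fst (repr g)); rewrite -[LHS]reprK pi_eval /eval_word big_map.
apply: eq_bigr => -[t []] _ //=.
by apply/(mulgI (pres_gen R t)); rewrite mulgV pres_gen_sqr.
Qed.

Section Action.
Variables (X : Type) (a : T -> X -> X).
Hypothesis aK : forall t, involutive (a t).

Definition act_word (w : word T) (x : X) : X := foldr (fun l => a l.1) x w.

Lemma act_cat u v x : act_word (u ++ v) x = act_word u (act_word v x).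
Proof. by rewrite /act_word foldr_cat. Qed.

Hypothesis aR : forall u v, R u v -> act_word u =1 act_word v.

Lemma pres_act : exists act : presented R -> X -> X,
  [/\ forall x, act 1 x = x, forall g h x, act (g * h) x = act g (act h x)
    & forall t x, act (pres_gen R t) x = a t x].
Proof.
have aE u v : pres_eq R u v -> act_word u =1 act_word v.
  elim=> {u v} [u v|[t b]|u|u v _ IH|u v w _ IH1 _ IH2
    |u u' v v' _ IH1 _ IH2] x //.
  - by move=> uv; apply: aR.
  - exact: aK.
  - by rewrite IH1.
  - by rewrite !act_cat IH2 IH1.
exists (fun g => act_word (repr g)); split=> [x|g h x|t x].
- exact: (aE _ _ (pres_repr R [::])).
- by rewrite -act_cat; apply: (aE _ _ (pres_repr R _)).
- exact: (aE _ _ (pres_repr R _)).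
Qed.

End Action.
End InvolutivePresentation.

(** * Sub-diagrams determine their endpoints *)

Section Diagrams.
Local Open Scope nat_scope.
Variable n : nat.

Lemma itvP p q i (lt_i : i < 2 * n) :
  (Ordinal lt_i \in itv n p q) = (p <= i <= q).
Proof. by rewrite inE. Qed.

Lemma ditvP p q i (lt_i : i < 2 * n) : (Ordinal lt_i \in ditv n p q) =
  (p <= i <= q) || (2 * n - q <= i <= 2 * n - p).
Proof. by rewrite !inE. Qed.

Lemma itv_inj p q k l : p <= q -> q < 2 * n -> k <= l -> l < 2 * n ->
  itv n p q = itv n k l -> p = k /\ q = l.
Proof.
move=> pq qn kl ln E.
have h i (i_n : i < 2 * n) : (p <= i <= q) = (k <= i <= l).
  by rewrite -!(itvP _ _ i_n) E.
have := h p; have := h q; have := h k; have := h l; lia.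
Qed.

Lemma ditv_inj p q k l :
  0 < p -> p <= q -> q <= n -> 0 < k -> k <= l -> l <= n ->
  ditv n p q = ditv n k l -> p = k /\ q = l.
Proof.
move=> p0 pq qn k0 kl ln E.
(* Only the nodes up to the middle are compared. *)
have h i : i <= n -> (p <= i <= q) = (k <= i <= l).
  move=> i_n; have i_2n : i < 2 * n by lia.
  have : (Ordinal i_2n \in ditv n p q) = (Ordinal i_2n \in ditv n k l).
    by rewrite E.
  by rewrite !ditvP; lia.
have := h p; have := h q; have := h k; have := h l; lia.
Qed.

Lemma disconnected_itv p q k l : p <= q -> q < 2 * n -> k <= l -> l < 2 * n ->
  disconnected (itv n p q) (itv n k l) <-> (q.+1 < k) || (l.+1 < p).
Proof.
move=> pq qn kl ln; split=> [dis|far i j].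
  have h i j (i_n : i < 2 * n) (j_n : j < 2 * n) : p <= i <= q -> k <= j <= l ->
      [/\ i <> j, i.+1 <> j & j.+1 <> i].
    move=> ip jk; have [] := dis (Ordinal i_n) (Ordinal j_n).
    - by rewrite itvP.
    - by rewrite itvP.
    by move=> ne *; split=> // ij; apply: ne; apply: val_inj.
  apply: contrapT => near.
  have [] := h (minn q (maxn p k.-1)) (minn l (maxn k p.-1)); lia.
by rewrite !inE => ip jk; split=> [/(congr1 val) /=| |]; lia.
Qed.

Lemma disconnected_ditv p q k l :
  0 < p -> p <= q -> q <= n -> 0 < k -> k <= l -> l <= n ->
  disconnected (ditv n p q) (ditv n k l) <-> (q.+1 < k) || (l.+1 < p).
Proof.
move=> p0 pq qn k0 kl ln; split=> [dis|far i j].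
  rewrite -disconnected_itv; try lia.
  by move=> i j ip jk; apply: dis; rewrite inE ?ip ?jk.
by rewrite !inE => ip jk; split=> [/(congr1 val) /=| |]; lia.
Qed.

End Diagrams.


(** * The virtualization morphism *)

Section Cactus.
Local Open Scope group_scope.
Variable n : nat.

(** Indexing generators by endpoints, with value 1 where the diagram is not
    admissible, lets the relations be used as equations between values of
    functions of two natural numbers. *)
Definition cgen (p q : nat) : cactus n :=
  if insub (itv n p q) is Some J then pres_gen (@cactus_rel n) J else 1.

(** The case q = n is the symmetric interval [p,2n-p]. *)
Definition vgen (p q : nat) : virtual_cactus n :=
  if insub (ditv n p q) is Some J then pres_gen (@virtual_rel n) J else 1.

Lemma cgenE (J : cactus_gen n) p q :
  val J = itv n p q -> cgen p q = pres_gen (@cactus_rel n) J.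
Proof. by rewrite /cgen => <-; rewrite valK. Qed.

Lemma vgenE (J : virtual_gen n) p q :
  val J = ditv n p q -> vgen p q = pres_gen (@virtual_rel n) J.
Proof. by rewrite /vgen => <-; rewrite valK. Qed.

Lemma cactus_gen_itv p q : (0 < p)%N -> (p <= q)%N -> (q < 2 * n)%N ->
  exists J : cactus_gen n, val J = itv n p q.
Proof.
move=> p0 pq qn; have H : `[< is_interval (itv n p q) >].
  by apply/asboolP; exists p, q; split=> //; lia.
by exists (Sub (itv n p q) H).
Qed.

Lemma virtual_gen_ditv p q : (0 < p)%N -> (p <= q)%N -> (q <= n)%N ->
  exists J : virtual_gen n, val J = ditv n p q.
Proof.
move=> p0 pq qn; have H : `[< is_virtual (ditv n p q) >].
  apply/asboolP; case: (eqVneq q n) => [->|qn'].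
    by left; exists p; split; [|lia|apply: ditv_n; lia].
  by right; exists p, q; split=> //; lia.
by exists (Sub (ditv n p q) H).
Qed.

Lemma cactus_gen_ends (J : cactus_gen n) :
  exists pq, [/\ (0 < pq.1)%N, (pq.1 <= pq.2)%N, (pq.2 < 2 * n)%N
    & val J = itv n pq.1 pq.2].
Proof.
have /asboolP[p [q [p1 pq qn E]]] := valP J.
by exists (p, q); split=> //=; lia.
Qed.

Lemma virtual_gen_ends (J : virtual_gen n) :
  exists pq, [/\ (0 < pq.1)%N, (pq.1 <= pq.2)%N, (pq.2 <= n)%N
    & val J = ditv n pq.1 pq.2].
Proof.
have /asboolP[[p [p1 pn E]]|[p [q [p1 pq qn E]]]] := valP J.
  by exists (p, n); rewrite /= ditv_n.
by exists (p, q); split=> //=; lia.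
Qed.

Lemma cgen_sqr p q : cgen p q * cgen p q = 1.
Proof.
rewrite /cgen; case: insub => [J|]; last by rewrite mulg1.
by apply: pres_gen_sqr => t; constructor.
Qed.

Lemma vgen_sqr p q : vgen p q * vgen p q = 1.
Proof.
rewrite /vgen; case: insub => [J|]; last by rewrite mulg1.
by apply: pres_gen_sqr => t; constructor.
Qed.

Lemma cgen_far p q k l : (0 < p)%N -> (p <= q)%N -> (q < 2 * n)%N ->
    (0 < k)%N -> (k <= l)%N -> (l < 2 * n)%N -> (q.+1 < k)%N || (l.+1 < p)%N ->
  commute (cgen p q) (cgen k l).
Proof.
move=> p0 pq qn k0 kl ln far.
have [J JE] := cactus_gen_itv p0 pq qn; have [K KE] := cactus_gen_itv k0 kl ln.
rewrite /commute (cgenE JE) (cgenE KE); apply: pres_rel2; constructor.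
by rewrite JE KE disconnected_itv.
Qed.

Lemma cgen_nested p q k l : (0 < p)%N -> (p <= k)%N -> (k <= l)%N ->
    (l <= q)%N -> (q < 2 * n)%N ->
  cgen p q * cgen k l = cgen (p + q - l) (p + q - k) * cgen p q.
Proof.
move=> p0 pk kl lq qn.
have [|||J JE] := @cactus_gen_itv p q; try lia.
have [|||K KE] := @cactus_gen_itv k l; try lia.
have [|||K' KE'] := @cactus_gen_itv (p + q - l) (p + q - k); try lia.
rewrite (cgenE JE) (cgenE KE) (cgenE KE'); apply: pres_rel2.
by apply: (CactusFlip _ pk kl lq _ JE KE KE'); lia.
Qed.

Lemma vgen_far p q k l : (0 < p)%N -> (p <= q)%N -> (q <= n)%N ->
    (0 < k)%N -> (k <= l)%N -> (l <= n)%N -> (q.+1 < k)%N || (l.+1 < p)%N ->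
  commute (vgen p q) (vgen k l).
Proof.
move=> p0 pq qn k0 kl ln far.
have [J JE] := virtual_gen_ditv p0 pq qn.
have [K KE] := virtual_gen_ditv k0 kl ln.
rewrite /commute (vgenE JE) (vgenE KE); apply: pres_rel2; constructor.
by rewrite JE KE disconnected_ditv.
Qed.

Lemma vgen_central p q l :
  (0 < p)%N -> (p <= q)%N -> (q <= l)%N -> (l <= n)%N ->
  commute (vgen p n) (vgen q l).
Proof.
move=> p0 pq ql ln.
have [|||J JE] := @virtual_gen_ditv p n; try lia.
have [|||K KE] := @virtual_gen_ditv q l; try lia.
rewrite /commute (vgenE JE) (vgenE KE); apply: pres_rel2.
by apply: (VirtualCentral p0 pq ql ln) => //; rewrite JE ditv_n //; lia.
Qed.

Lemma vgen_nested p q k l : (0 < p)%N -> (p <= k)%N -> (k <= l)%N ->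
    (l <= q)%N -> (q < n)%N ->
  vgen p q * vgen k l = vgen (p + q - l) (p + q - k) * vgen p q.
Proof.
move=> p0 pk kl lq qn.
have [|||J JE] := @virtual_gen_ditv p q; try lia.
have [|||K KE] := @virtual_gen_ditv k l; try lia.
have [|||K' KE'] := @virtual_gen_ditv (p + q - l) (p + q - k); try lia.
rewrite (vgenE JE) (vgenE KE) (vgenE KE'); apply: pres_rel2.
by apply: (VirtualFlip _ pk kl lq _ JE KE KE'); lia.
Qed.

Lemma cactus_act : exists act : cactus n -> ((nat -> bool) -> int) -> _,
  [/\ forall f, act 1 f = f, forall g h f, act (g * h) f = act g (act h f)
    & forall p q f, (0 < p)%N -> (p <= q)%N -> (q < 2 * n)%N ->
        act (cgen p q) f = cactus_flip p q f].
Proof.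
pose e J := projT1 (cid (cactus_gen_ends J)).
pose a J := cactus_flip (e J).1 (e J).2.
have aE J p q : (0 < p)%N -> (p <= q)%N -> (q < 2 * n)%N -> val J = itv n p q ->
    a J = cactus_flip p q.
  move=> p0 pq qn JE; rewrite /a /e; case: cid => -[k l] /= [k0 kl ln].
  by rewrite JE => /itv_inj[] // -> ->.
have aK J : involutive (a J) by apply: cactus_flipK.
have aR u v : cactus_rel u v -> act_word a u =1 act_word a v.
  case=> {u v} [J|J J' dis|p q k l J K K' p0 pk kl lq qn JE KE KE'] f /=.
  - exact: aK.
  - have [[p q] /= [p0 pq qn JE]] := cactus_gen_ends J.
    have [[k l] /= [k0 kl ln KE]] := cactus_gen_ends J'.
    rewrite !(aE _ _ _ p0 pq qn JE) !(aE _ _ _ k0 kl ln KE).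
    by apply: cactus_flip_far => //; rewrite -(@disconnected_itv n) // -JE -KE.
  - rewrite !(aE J p q) ?(aE K k l) ?(aE K' _ _ _ _ _ KE') //; try lia.
    exact: cactus_flip_nested.
have [act [act1 actM actE]] := pres_act aK aR.
exists act; split=> // p q f p0 pq qn.
by have [J JE] := cactus_gen_itv p0 pq qn; rewrite (cgenE JE) actE (aE J p q).
Qed.

Definition vimage (p q : nat) : cactus n :=
  if q == n then cgen p (2 * n - p)
  else cgen p q * cgen (2 * n - q) (2 * n - p).

Lemma vimage_sqr p q : (0 < p)%N -> (p <= q)%N -> (q <= n)%N ->
  vimage p q * vimage p q = 1.
Proof.
move=> p0 pq qn; rewrite /vimage.
case: eqVneq => [_|qn']; first exact: cgen_sqr.
have C : commute (cgen p q) (cgen (2 * n - q) (2 * n - p)).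
  by apply: cgen_far; lia.
by rewrite {1}C -mulgA (mulgA (cgen p q)) cgen_sqr mul1g cgen_sqr.
Qed.

Lemma vimage_far p q k l : (0 < p)%N -> (p <= q)%N -> (q <= n)%N ->
    (0 < k)%N -> (k <= l)%N -> (l <= n)%N -> (q.+1 < k)%N || (l.+1 < p)%N ->
  commute (vimage p q) (vimage k l).
Proof.
move=> p0 pq qn k0 kl ln far; rewrite /vimage.
case: eqVneq => [?|?]; case: eqVneq => [?|?]; try apply: commuteM;
  try (apply: commute_sym; apply: commuteM);
  by [apply: cgen_far; lia | apply: commute_sym; apply: cgen_far; lia].
Qed.

(** The symmetric generator exchanges the two factors of the image, which
    commute. *)
Lemma vimage_central p q l :
  (0 < p)%N -> (p <= q)%N -> (q <= l)%N -> (l <= n)%N ->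
  commute (vimage p n) (vimage q l).
Proof.
move=> p0 pq ql ln; rewrite /vimage eqxx /commute.
have E k m : (p <= k)%N -> (k <= m)%N -> (m <= 2 * n - p)%N ->
  cgen p (2 * n - p) * cgen k m =
    cgen (2 * n - m) (2 * n - k) * cgen p (2 * n - p).
  by move=> *; rewrite cgen_nested; [congr (cgen _ _ * _); lia|lia..].
case: eqVneq => [_|?].
  by rewrite E; [congr (cgen _ _ * _); lia|lia..].
have C : commute (cgen q l) (cgen (2 * n - l) (2 * n - q)).
  by apply: cgen_far; lia.
rewrite mulgA E; try lia; rewrite -mulgA E; try lia.
by rewrite !subKn; [rewrite mulgA -C|lia..].
Qed.

Lemma vimage_nested p q k l : (0 < p)%N -> (p <= k)%N -> (k <= l)%N ->
    (l <= q)%N -> (q < n)%N ->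
  vimage p q * vimage k l = vimage (p + q - l) (p + q - k) * vimage p q.
Proof.
move=> p0 pk kl lq qn; rewrite /vimage !ifN; try lia.
set a := cgen p q; set b := cgen (2 * n - q) _.
set c := cgen k l; set d := cgen (2 * n - l) _.
set c' := cgen (p + q - l) _; set d' := cgen (2 * n - _) (2 * n - (p + q - l)).
have bc : commute b c by apply: cgen_far; lia.
have ad' : commute a d' by apply: cgen_far; lia.
have ac : a * c = c' * a by apply: cgen_nested; lia.
have bd : b * d = d' * b.
  by rewrite /b /d cgen_nested; [congr (cgen _ _ * _); lia|lia..].
rewrite -!mulgA [b * (c * d)]mulgA bc -!mulgA bd !mulgA ac.
by rewrite -[c' * a * d']mulgA ad' !mulgA.
Qed.

Lemma virtualization :
  exists phi : UMagmaMorphism.type (virtual_cactus n) (cactus n),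
    forall p q, (0 < p)%N -> (p <= q)%N -> (q <= n)%N ->
      phi (vgen p q) = vimage p q.
Proof.
pose e J := projT1 (cid (virtual_gen_ends J)).
pose a J := vimage (e J).1 (e J).2.
have aE J p q : (0 < p)%N -> (p <= q)%N -> (q <= n)%N -> val J = ditv n p q ->
    a J = vimage p q.
  move=> p0 pq qn JE; rewrite /a /e; case: cid => -[k l] /= [k0 kl ln].
  by rewrite JE => /ditv_inj[] // -> ->.
have aR u v : virtual_rel u v -> eval_word a u = eval_word a v.
  case=> {u v} [J|J J' dis|p q l J K p0 pq ql ln JE KE
    |p q k l J K K' p0 pk kl lq qn JE KE KE']; rewrite !eval_two.
  - have [[p q] /= [p0 pq qn JE]] := virtual_gen_ends J.
    by rewrite (aE _ _ _ p0 pq qn JE) vimage_sqr // /eval_word big_nil.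
  - have [[p q] /= [p0 pq qn JE]] := virtual_gen_ends J.
    have [[k l] /= [k0 kl ln KE]] := virtual_gen_ends J'.
    rewrite (aE _ _ _ p0 pq qn JE) (aE _ _ _ k0 kl ln KE).
    by apply: vimage_far => //; rewrite -(@disconnected_ditv n) // -JE -KE.
  - rewrite (aE J p n) ?(aE K q l) ?ditv_n //; try lia.
    exact: vimage_central.
  - rewrite (aE J p q) ?(aE K k l) ?(aE K' _ _ _ _ _ KE') //; try lia.
    by apply: vimage_nested; lia.
have [phi [phiE _]] := presented_universal aR.
have phi1 : phi 1 = 1 by apply: (mulgI (phi 1)); rewrite -gmulfM !mulg1.
pose phi1M := Multiplicative_isUMagmaMorphism.Build _ _ phi phi1.
pose psi : UMagmaMorphism.type _ _ :=
  HB.pack (Multiplicative.sort phi) (Multiplicative.class phi) phi1M.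
exists psi => p q p0 pq qn.
have [J JE] := virtual_gen_ditv p0 pq qn.
by rewrite (vgenE JE) phiE (aE J p q).
Qed.

End Cactus.

(** * Words of minimal length act nontrivially *)

Section Injectivity.
Variable n : nat.

Definition valid (p q : nat) : bool := [&& 0 < p, p <= q & q <= n].

(** The sets of strands reversed by the factors of [vimage p q]. *)
Definition half (p q : nat) (A : nat -> bool) : Prop :=
  if q == n then A = seg p (2 * n - p).+1
  else A = seg p q.+1 \/ A = seg (2 * n - q) (2 * n - p).+1.

Definition vimage_act (p q : nat) (f : (nat -> bool) -> int) :
    (nat -> bool) -> int :=
  if q == n then cactus_flip p (2 * n - p) f
  else cactus_flip p q (cactus_flip (2 * n - q) (2 * n - p) f).

Definition vimage_rev (p q : nat) (A : nat -> bool) : nat -> bool :=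
  if q == n then A \o rev_seg p (2 * n - p).+1
  else A \o rev_seg p q.+1 \o rev_seg (2 * n - q) (2 * n - p).+1.

Lemma half_inj p q k l A : valid p q -> valid k l ->
  half p q A -> half k l A -> p = k /\ q = l.
Proof.
rewrite /valid /half => pq kl.
case: eqVneq => [?|?]; case: eqVneq => [?|?].
- by move=> -> /seg_inj; lia.
- by move=> -> [] /seg_inj; lia.
- by case=> -> /seg_inj; lia.
- by case=> -> [] /seg_inj; lia.
Qed.

(** The two reflections in the halves of a generator commute, and so do the two
    reversals: if f is positive on the halves, both steps are reflections in a
    set on which the current function is positive. *)
Lemma vimage_act_positive k l f : valid k l -> positive_pairs f ->
  (forall B, half k l B -> 0 < f B)%R ->
  [/\ positive_pairs (vimage_act k l f),
      exists2 A, half k l A & (vimage_act k l f A < 0)%R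
    & forall A, (vimage_act k l f A < 0)%R -> half k l A \/
      (forall B, half k l B -> laminar A B) /\ (f (vimage_rev k l A) < 0)%R].
Proof.
rewrite /valid /half /vimage_act /vimage_rev => kl fp.
case: eqVneq => [_|ln] B0.
  have K0 := B0 _ erefl.
  split; first exact: twisted_refl_positive (@rev_segK _ _) (@seg_rev _ _) _ _.
    eexists; first reflexivity.
    by rewrite /cactus_flip twisted_refl_self ?seg_rev // oppr_lt0.
  move=> A /(twisted_refl_negative (@rev_segK _ _) (@seg_rev _ _) fp K0).
  case=> [->|[_ AK fA]]; first by left.
  by right; split=> // B ->.
set K := seg k l.+1 in B0 *; set K' := seg (2 * n - l) _ in B0 *.
set r := rev_seg k _; set r' := rev_seg (2 * n - l) _.
have K0 : (0 < f K)%R by apply: B0; left.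
have K'0 : (0 < f K')%R by apply: B0; right.
have rK : involutive r by apply: rev_segK.
have rK' : involutive r' by apply: rev_segK.
have Kr : K \o r = K by apply: seg_rev.
have Kr' : K' \o r' = K' by apply: seg_rev.
have K'r : K' \o r = K' by apply: seg_rev_far; lia.
have Kr'' : K \o r' = K by apply: seg_rev_far; lia.
have fp1 := twisted_refl_positive rK' Kr' fp K'0.
(* Reflecting in the mirror image first leaves K, which is disjoint from it,
   positive. *)
have K1 : (0 < twisted_refl K' r' f K)%R.
  have [f0 _] := fp1; have := f0 K.
  case: (ltrgtP 0%R (twisted_refl K' r' f K)) => // h _.
  have [E|[_ _]] := twisted_refl_negative rK' Kr' fp K'0 h; last first.
    by rewrite Kr''; lia.
  by have [] := seg_inj _ E; lia.
split; first exact: twisted_refl_positive rK Kr fp1 K1.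
  by exists K; [left | rewrite /cactus_flip twisted_refl_self // oppr_lt0].
move=> A /(twisted_refl_negative rK Kr fp1 K1)[->|[_ AK]]; first by left; left.
move=> /(twisted_refl_negative rK' Kr' fp K'0)[E|[_ AK' fA]].
  by left; right; rewrite -[LHS](comp_involK A rK) E.
right; split=> // B [->//|->].
by have := laminar_comp r AK'; rewrite K'r comp_involK.
Qed.

Local Open Scope group_scope.

(** The commutation of the Coxeter generator of A with those of both halves of K
    lifts to a relation of the virtual group.  When J is nested in K it is J
    that changes, when K is nested in J it is K, and disconnected or symmetric
    generators simply commute. *)
Lemma vgen_exchange p q k l A : valid p q -> valid k l -> half p q A ->
  (forall B, half k l B -> laminar A B) ->
  exists p' q' k' l', [/\ valid p' q', valid k' l',
      half p' q' (vimage_rev k l A)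
    & vgen n p q * vgen n k l = vgen n k' l' * vgen n p' q'].
Proof.
rewrite /valid => pq kl pA lam.
have stay : commute (vgen n p q) (vgen n k l) -> half p q (vimage_rev k l A) ->
  exists p' q' k' l', [/\ valid p' q', valid k' l',
      half p' q' (vimage_rev k l A)
    & vgen n p q * vgen n k l = vgen n k' l' * vgen n p' q'].
  by move=> C pT; exists p, q, k, l.
move: pA lam stay; rewrite /half /vimage_rev.
case: (eqVneq l n) => [ln|ln]; case: (eqVneq q n) => [qn|qn].
- subst l q => -> _; apply.
    case: (leqP p k) => pk; first by apply: vgen_central; lia.
    by apply: commute_sym; apply: vgen_central; lia.
  case: (leqP p k) => pk; first by apply: seg_rev_out; lia.
  by rewrite seg_rev_in; [congr seg; lia|lia..].
- subst l => pA /(_ _ erefl) lam; apply.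
    case: pA => E; subst A;
      have [||h|h|h|h] := laminar_seg _ _ lam; try lia;
      by [apply: vgen_far; lia | apply: commute_sym; apply: vgen_central; lia].
  case: pA => E; subst A;
    have [||h|h|h|h] := laminar_seg _ _ lam; try lia.
  + by left; apply: seg_rev_far; lia.
  + by right; rewrite seg_rev_in; [congr seg; lia|lia..].
  + by right; apply: seg_rev_far; lia.
  + by left; rewrite seg_rev_in; [congr seg; lia|lia..].
- subst q => -> /(_ _ (or_introl erefl)) lam; apply;
    have [||h|h|h|h] := laminar_seg _ _ lam; try lia.
  + by apply: commute_sym; apply: vgen_far; lia.
  + by apply: vgen_central; lia.
  + by rewrite !seg_rev_far //; lia.
  + by rewrite !seg_rev_out //; lia.
- move=> pA lam stay.
  have [h|/orP h|h] : [\/ (k <= p) && (q <= l), (q.+1 < k) || (l.+1 < p)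
      | (p <= k) && (l <= q)].
    case: pA => E; subst A;
      [have {}lam := lam _ (or_introl erefl)
      |have {}lam := lam _ (or_intror erefl)];
      have [||h|h|h|h] := laminar_seg _ _ lam; try lia;
      by [constructor 1; lia | constructor 2; lia | constructor 3; lia].
  + exists (k + l - q), (k + l - p), k, l; split; rewrite /valid; try lia.
      rewrite ifN; last lia.
      case: pA => ->; [left|right].
        by rewrite seg_rev_in ?seg_rev_far; [congr seg; lia|lia..].
      by rewrite seg_rev_far ?seg_rev_in; [congr seg; lia|lia..].
    by rewrite [RHS]vgen_nested; [congr (vgen _ _ _ * _); lia|lia..].
  + apply: stay; first by apply: vgen_far; lia.
    by case: pA => ->; [left|right]; rewrite !seg_rev_far //; lia.
  + exists p, q, (p + q - l), (p + q - k); split; rewrite /valid; try lia.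
      rewrite ifN //; case: pA => ->; [left|right].
        by rewrite seg_rev_out ?seg_rev_far //; lia.
      by rewrite seg_rev_far ?seg_rev_out //; lia.
    by apply: vgen_nested; lia.
Qed.

Definition vprod (v : seq (nat * nat)) : virtual_cactus n :=
  \prod_(x <- v) vgen n x.1 x.2.

Definition shorter (m : nat) (g : virtual_cactus n) : Prop :=
  exists v, [/\ all (fun x => valid x.1 x.2) v, size v < m & vprod v = g].

(** For [g] a product of [m] generators and [f] the image of the constant 1
    under [g]: negative values of [f] witness that [g] can be shortened from the
    left, as in the exchange condition of Coxeter groups. *)
Definition certified (m : nat) (g : virtual_cactus n)
    (f : (nat -> bool) -> int) :=
  positive_pairs f /\ forall p q A, valid p q -> half p q A ->
    (f A < 0)%R -> shorter m (vgen n p q * g).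

Lemma vprod_cons x v : vprod (x :: v) = vgen n x.1 x.2 * vprod v.
Proof. by rewrite /vprod big_cons. Qed.

Lemma shorterW m m' g : m <= m' -> shorter m g -> shorter m' g.
Proof. by move=> mm [v [? ? ?]]; exists v; split=> //; lia. Qed.

Lemma shorter_cons m p q g : valid p q -> shorter m g ->
  shorter m.+1 (vgen n p q * g).
Proof.
by move=> pq [v [? ? <-]]; exists ((p, q) :: v); rewrite vprod_cons /= pq.
Qed.

(** Minimality of the longer word forces f to be positive on the halves of the
    new letter K.  A later negative value is either at a half of K, where K
    cancels K, or comes from a negative value of f, and then the exchange moves
    the corresponding generator past K, to where g absorbs it. *)
Lemma certified_cons m k l g f :
  valid k l -> shorter m.+1 g -> certified m g f ->
  ~ shorter m.+1 (vgen n k l * g) ->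
  certified m.+1 (vgen n k l * g) (vimage_act k l f) /\
  exists A, (vimage_act k l f A < 0)%R.
Proof.
move=> kl gm [fp fs] irr.
have B0 B : half k l B -> (0 < f B)%R.
  move=> kB; have [f0 _] := fp; have := f0 B.
  case: (ltrgtP 0%R (f B)) => // fB _; case: irr.
  exact: shorterW (fs _ _ _ kl kB fB).
have [Fp [A _ FA] Fn] := vimage_act_positive kl fp B0.
split; last by exists A.
split=> // p q {FA}A pq pA /Fn[kA|[lam fA]].
  have [-> ->] := half_inj pq kl pA kA.
  by rewrite mulgA vgen_sqr mul1g; apply: shorterW gm; lia.
have [p' [q' [k' [l' [pq' kl' pT E]]]]] := vgen_exchange pq kl pA lam.
rewrite mulgA E -mulgA; apply: shorter_cons => //.
exact: fs pT fA.
Qed.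

Lemma vprod_surj (g : virtual_cactus n) :
  exists2 v, all (fun x => valid x.1 x.2) v & vprod v = g.
Proof.
have [s ->] := pres_gen_prod (@VirtualInvol n) g.
elim: s => [|J s [v vv E]]; first by exists [::]; rewrite // /vprod !big_nil.
have [pq [p0 pq1 pqn JE]] := virtual_gen_ends J.
exists (pq :: v); first by rewrite /= vv /valid p0 pq1 pqn.
by rewrite vprod_cons big_cons E (vgenE JE).
Qed.

Lemma irreducible_word (g : virtual_cactus n) :
  exists v, [/\ all (fun x => valid x.1 x.2) v, vprod v = g
    & ~ shorter (size v) g].
Proof.
have [v vv E] := vprod_surj g.
have ex : exists m, `[< shorter m g >].
  by exists (size v).+1; apply/asboolP; exists v.
case: (ex_minnP ex) => m /asboolP[w [vw wm wE]] mmin.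
exists w; split=> // /asboolP/mmin; lia.
Qed.

Lemma virtualization_injective :
  exists phi : UMagmaMorphism.type (virtual_cactus n) (cactus n), injective phi.
Proof.
have [phi phiE] := virtualization n; exists phi.
have [act [act1 actM actE]] := cactus_act n.
have actF p q f : valid p q -> act (phi (vgen n p q)) f = vimage_act p q f.
  rewrite /valid => pq; rewrite phiE; try lia.
  rewrite /vimage /vimage_act.
  case: eqVneq => [?|?]; first by rewrite actE //; lia.
  by rewrite actM !actE //; lia.
pose f0 (A : nat -> bool) : int := 1%R.
have key v : all (fun x => valid x.1 x.2) v -> ~ shorter (size v) (vprod v) ->
    certified (size v) (vprod v) (act (phi (vprod v)) f0) /\
    (v = [::] \/ exists A, (act (phi (vprod v)) f0 A < 0)%R).
  elim: v => [_ _|[k l] v IH /= /andP[kl vv]].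
    split; last by left.
    rewrite /vprod big_nil gmulf1 act1; split; last by [].
    by split=> [A|A B _].
  rewrite vprod_cons /= => irr.
  have [|sv _] := IH vv; first by move=> /(shorter_cons kl).
  rewrite gmulfM actM actF //.
  have vsh : shorter (size v).+1 (vprod v) by exists v.
  have [sF nF] := certified_cons kl vsh sv irr.
  by split; last right.
apply: gmulf_inj => g g1.
have [[|x v] [vv E irr]] := irreducible_word g.
  by rewrite -E /vprod big_nil.
have [|_ [//|[A]]] := key (x :: v) vv; first by rewrite E.
by rewrite E g1 act1 /f0 ltr10.
Qed.

End Injectivity.

Section ImageSubgroup.
Local Open Scope group_scope.

Lemma image_subgroup (G K : groupType) (phi : UMagmaMorphism.type G K) :
  injective phi ->
  exists (S : pred K) (H : subGroupType S) (f : {multiplicative G -> H}),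
    bijective f.
Proof.
move=> phi_inj; pose S : pred K := fun y => `[< exists x, phi x = y >].
have Sgrp : group_closed S.
  split=> [|_ _ /asboolP[x <-] /asboolP[y <-]]; apply/asboolP.
    by exists 1; rewrite gmulf1.
  by exists (x / y); rewrite gmulfF.
pose H0 := {y : K | S y}.
pose mH := SubChoice_isSubGroup.Build K S H0 Sgrp.
pose H : subGroupType S := HB.pack H0 mH.
have Sphi x : S (phi x) by apply/asboolP; exists x.
pose f0 x : H := Sub (phi x) (Sphi x).
have f0M : {morph f0 : x y / x * y}.
  by move=> x y; apply: val_inj; rewrite valM !SubK gmulfM.
pose mf := isMultiplicative.Build _ _ f0 f0M.
pose f : {multiplicative G -> H} := HB.pack f0 mf.
exists S, H, f.
have pre (y : H) : exists x, phi x = val y by apply/asboolP/(valP y).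
exists (fun y => projT1 (cid (pre y))) => z; case: cid => x /= xE.
  exact: phi_inj xE.
exact: val_inj.
Qed.

End ImageSubgroup.

Theorem proposition5 (n : nat) (n_ge1 : 1 <= n) :
  exists (S : pred (cactus n)) (H : subGroupType S)
         (f : {multiplicative virtual_cactus n -> H}),
    bijective f.
Proof.
by have [phi /image_subgroup] := virtualization_injective n.
Qed.
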